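(* Let $\alpha>1$. If $x>0$, $y\in\mathbb R$, and $$\Gamma\left(\frac\alpha2+x+iy\right)\Gamma\left(\frac\alpha2-x-iy\right)$$ is finite, then $$\left|\Gamma\left(\frac\alpha2+x+iy\right)\Gamma\left(\frac\alpha2-x-iy\right)\right|>\left|\Gamma\left(\frac\alpha2+iy\right)\right|^2.$$
   Context: $\Gamma$ is the Gamma function, meromorphic on $\mathbb C$ with poles at $0,-1,-2,\dots$; ''finite'' means that $\frac\alpha2-x-iy$ is not a pole of $\Gamma$. *)

(* Defs.v *)
From Stdlib Require Import Reals Factorial Lra Lia.
From Coquelicot Require Import Coquelicot.

Local Open Scope R_scope.

Definition Cexp (z : C) : C :=
  (exp (Re z) * cos (Im z), exp (Re z) * sin (Im z)).

(* rising z n = z (z + 1) ... (z + n - 1) *)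
Fixpoint rising (z : C) (n : nat) : C :=
  match n with
  | O => 1
  | S m => Cmult (rising z m) (Cplus z (INR m))
  end.

(* n! n^z / (z (z + 1) ... (z + n)), where n^z = exp (z ln n); the term n = 0
   carries no meaning (Stdlib sets ln 0 = 0) and does not affect the limit. *)
Definition euler_gauss (z : C) (n : nat) : C :=
  Cdiv (Cmult (INR (fact n)) (Cexp (Cmult z (ln (INR n))))) (rising z (S n)).

(* The Gamma function on all of C minus its poles, by the Euler-Gauss limit
     Gamma z = lim_n n! n^z / (z (z + 1) ... (z + n)).
   Lim_seq is total: Gamma_is_lim below shows that off the poles the limit
   exists, so that no default value is involved there; Gamma_1 and Gamma_succ
   give the usual normalisation and functional equation.  The value at a pole
   is junk. *)
Definition Gamma (z : C) : C :=
  (real (Lim_seq (fun n => Re (euler_gauss z n))),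
   real (Lim_seq (fun n => Im (euler_gauss z n)))).

Definition Gamma_pole (z : C) : Prop := exists n : nat, z = Copp (INR n).

Lemma Cexp_plus (a b : C) : Cexp (Cplus a b) = Cmult (Cexp a) (Cexp b).
Proof.
  destruct a as [a1 a2], b as [b1 b2]; unfold Cexp, Cmult, Cplus; simpl.
  rewrite exp_plus, cos_plus, sin_plus; f_equal; ring.
Qed.

Lemma rising_neq_0 (z : C) (n : nat) : ~ Gamma_pole z -> rising z n <> 0.
Proof.
  intros Hz; induction n as [|n IH]; simpl.
  - intros E; injection E; lra.
  - apply Cmult_neq_0; [exact IH|].
    intros E; apply Hz; exists n.
    replace z with (Cminus (Cplus z (INR n)) (INR n)) by ring.
    rewrite E; ring.
Qed.

Lemma exp_le_mono (a b : R) : a <= b -> exp a <= exp b.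
Proof. intros [H| ->]; [left; now apply exp_increasing|apply Rle_refl]. Qed.

Lemma exp_le_quadratic (a : R) : Rabs a <= 1 / 2 -> exp a <= 1 + a + 2 * a ^ 2.
Proof.
  intros H.
  assert (- (1 / 2) <= a <= 1 / 2) by (split_Rabs; lra).
  assert (H1 := exp_ineq1_le (- a)).
  rewrite exp_Ropp in H1.
  assert (H2 := exp_pos a).
  assert (H3 : exp a * (1 - a) <= 1).
  { apply Rmult_le_reg_r with (/ exp a); [now apply Rinv_0_lt_compat|].
    field_simplify; lra. }
  assert (1 <= (1 - a) * (1 + a + 2 * a ^ 2)) by nra.
  apply Rmult_le_reg_l with (1 - a); nra.
Qed.

Lemma sin_abs_le (b : R) : Rabs (sin b) <= Rabs b.
Proof.
  destruct (Req_dec b 0) as [->|Hb]; [rewrite sin_0; lra|].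
  assert (H : forall c, 0 < c -> Rabs (sin c) <= Rabs c).
  { intros c Hc.
    rewrite (Rabs_right c) by lra.
    apply Rabs_le; split; [|left; now apply sin_lt_x].
    destruct (Rle_dec c PI).
    - assert (0 <= sin c) by (apply sin_ge_0; lra); lra.
    - assert (H1 := SIN_bound c).
      assert (H2 := PI2_1); lra. }
  destruct (Rlt_dec 0 b) as [?|?]; [now apply H|].
  rewrite <- (Rabs_Ropp b), <- (Rabs_Ropp (sin b)), <- sin_neg.
  apply H; lra.
Qed.

Lemma one_sub_cos (b : R) : 0 <= 1 - cos b <= b ^ 2 / 2.
Proof.
  assert (E : 1 - cos b = 2 * (sin (b / 2)) ^ 2).
  { replace b with (2 * (b / 2)) at 1 by field.
    rewrite cos_2a_sin; ring. }
  assert (H := sin_abs_le (b / 2)).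
  rewrite E; split; [nra|].
  assert (sin (b / 2) ^ 2 <= (b / 2) ^ 2); [|nra].
  rewrite <- (pow2_abs (sin (b / 2))), <- (pow2_abs (b / 2)).
  apply pow_incr; split; [apply Rabs_pos|exact H].
Qed.

Lemma sin_sub_abs (b : R) : Rabs b <= 1 / 2 -> Rabs (sin b - b) <= b ^ 2.
Proof.
  assert (H : forall c, 0 <= c <= 1 / 2 -> Rabs (sin c - c) <= c ^ 2).
  { intros c Hc.
    assert (H3 := PI2_1).
    destruct (sin_bound c 0) as [H1 _]; [lra|lra|].
    unfold sin_approx, sin_term in H1; simpl in H1.
    assert (H2 : sin c <= c).
    { destruct (proj1 Hc) as [h|<-]; [left; now apply sin_lt_x|].
      rewrite sin_0; lra. }
    apply Rabs_le; split; [|nra].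
    assert (c - c ^ 3 / 6 <= sin c) by (simpl; lra).
    nra. }
  intros Hb; destruct (Rle_dec 0 b).
  - apply H; split; [lra|]; split_Rabs; lra.
  - rewrite <- Rabs_Ropp.
    replace (- (sin b - b)) with (sin (- b) - (- b)) by (rewrite sin_neg; ring).
    replace (b ^ 2) with ((- b) ^ 2) by ring.
    apply H; split_Rabs; lra.
Qed.

Lemma Cmod_le_Re_Im (z : C) : Cmod z <= Rabs (Re z) + Rabs (Im z).
Proof.
  destruct z as [a b]; simpl.
  replace (a, b) with (Cplus (RtoC a) (Cmult Ci (RtoC b)))
    by (unfold Cplus, Cmult, Ci, RtoC; simpl; f_equal; ring).
  eapply Rle_trans; [apply Cmod_triangle|].
  rewrite Cmod_mult, !Cmod_R.
  replace (Cmod Ci) with 1; [lra|].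
  unfold Cmod, Ci; simpl; rewrite <- sqrt_1 at 1; f_equal; ring.
Qed.

Lemma im_le_Cmod (z : C) : Rabs (Im z) <= Cmod z.
Proof. exact (Rle_trans _ _ _ (Rmax_r _ _) (Rmax_Cmod z)). Qed.

Lemma Cmod_sqr (z : C) : Cmod z ^ 2 = Re z ^ 2 + Im z ^ 2.
Proof. unfold Cmod; rewrite pow2_sqrt; [reflexivity|]; nra. Qed.

Lemma Cexp_quadratic (z : C) : Cmod z <= 1 / 2 ->
  Cmod (Cminus (Cexp z) (Cplus 1 z)) <= 8 * Cmod z ^ 2.
Proof.
  intros Hz.
  assert (Ha := re_le_Cmod z); assert (Hb := im_le_Cmod z).
  assert (Hsq := Cmod_sqr z).
  destruct z as [a b]; simpl Re in *; simpl Im in *.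
  set (r := Cmod (a, b)) in *.
  eapply Rle_trans; [apply Cmod_le_Re_Im|].
  unfold Cexp; simpl.
  assert (E1 := exp_ineq1_le a).
  assert (E2 := exp_le_quadratic a ltac:(lra)).
  assert (C1 := one_sub_cos b).
  assert (S1 := sin_sub_abs b ltac:(lra)).
  assert (S2 := sin_abs_le b).
  assert (E3 : exp a <= 2) by (split_Rabs; nra).
  assert (P := exp_pos a).
  assert (E4 : Rabs (exp a - 1) <= 2 * Rabs a) by (split_Rabs; nra).
  replace (exp a * cos b + - (1 + a))
    with ((exp a - 1 - a) + - (exp a * (1 - cos b))) by ring.
  replace (exp a * sin b + - (0 + b))
    with ((exp a - 1) * sin b + (sin b - b)) by ring.
  assert (T1 : Rabs (exp a - 1 - a + - (exp a * (1 - cos b)))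
               <= 2 * a ^ 2 + b ^ 2).
  { assert (0 <= exp a * (1 - cos b) <= b ^ 2) by nra.
    apply Rabs_le; nra. }
  assert (T2 : Rabs ((exp a - 1) * sin b) <= 2 * Rabs a * Rabs b).
  { rewrite Rabs_mult.
    apply Rmult_le_compat; auto using Rabs_pos. }
  assert (T3 : 2 * Rabs a * Rabs b <= a ^ 2 + b ^ 2).
  { rewrite <- (pow2_abs a), <- (pow2_abs b).
    assert (T := pow2_ge_0 (Rabs a - Rabs b)); nra. }
  assert (T4 := Rabs_triang ((exp a - 1) * sin b) (sin b - b)).
  nra.
Qed.

Lemma euler_gauss_S (z : C) (n : nat) : ~ Gamma_pole z -> (1 <= n)%nat ->
  euler_gauss z (S n) =
  Cmult (euler_gauss z n)
        (Cdiv (Cmult (INR (S n)) (Cexp (Cmult z (ln (INR (S n)) - ln (INR n)))))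
              (Cplus z (INR (S n)))).
Proof.
  intros Hz Hn.
  assert (R1 := rising_neq_0 z (S (S n)) Hz).
  assert (R2 := rising_neq_0 z (S n) Hz).
  assert (R3 : Cplus z (INR (S n)) <> 0).
  { intros E; apply R1.
    change (rising z (S (S n))) with (Cmult (rising z (S n)) (Cplus z (INR (S n)))).
    rewrite E; ring. }
  unfold euler_gauss.
  replace (Cmult z (ln (INR (S n)))) with
    (Cplus (Cmult z (ln (INR n))) (Cmult z (ln (INR (S n)) - ln (INR n)))).
  2:{ unfold Cmult, Cplus; simpl; f_equal; ring. }
  rewrite Cexp_plus.
  change (rising z (S (S n))) with (Cmult (rising z (S n)) (Cplus z (INR (S n)))).
  change (fact (S n)) with (S n * fact n)%nat.
  rewrite mult_INR, RtoC_mult.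
  field; split; assumption.
Qed.

Lemma ln_ratio (n : nat) : (1 <= n)%nat ->
  / INR (S n) <= ln (INR (S n)) - ln (INR n) <= / INR n.
Proof.
  intros Hn.
  assert (P : 0 < INR n) by (apply lt_0_INR; lia).
  assert (E := S_INR n).
  assert (L : forall t, 0 < t -> ln t <= t - 1).
  { intros t Ht.
    assert (H := exp_ineq1_le (ln t)); rewrite exp_ln in H; lra. }
  rewrite E; split.
  - assert (H := L (INR n / (INR n + 1)) ltac:(apply Rdiv_lt_0_compat; lra)).
    rewrite ln_div in H by lra.
    replace (INR n / (INR n + 1) - 1) with (- / (INR n + 1)) in H by (field; lra).
    lra.
  - assert (H := L ((INR n + 1) / INR n) ltac:(apply Rdiv_lt_0_compat; lra)).
    rewrite ln_div in H by lra.
    replace ((INR n + 1) / INR n - 1) with (/ INR n) in H by (field; lra).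
    lra.
Qed.

Lemma euler_gauss_ratio (z : C) (n : nat) : (1 <= n)%nat -> 2 * Cmod z <= INR n ->
  Cmod (Cminus
    (Cdiv (Cmult (INR (S n)) (Cexp (Cmult z (ln (INR (S n)) - ln (INR n)))))
          (Cplus z (INR (S n)))) 1)
  <= (32 * Cmod z ^ 2 + 4 * Cmod z) * (/ INR n - / INR (S n)).
Proof.
  intros Hn Hz.
  assert (HL := ln_ratio n Hn).
  assert (P : 1 <= INR n) by (apply (le_INR 1); lia).
  assert (E := S_INR n).
  rewrite E in *; set (N := INR n) in *; set (r := Cmod z) in *.
  set (L := ln (N + 1) - ln N) in *.
  assert (Hr : 0 <= r) by apply Cmod_ge_0.
  assert (I1 : 0 < / N) by (apply Rinv_0_lt_compat; lra).
  assert (I2 : 0 < / (N + 1)) by (apply Rinv_0_lt_compat; lra).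
  assert (ML : Cmod (Cmult z (ln (N + 1) - ln N)) = r * L).
  { rewrite <- RtoC_minus, Cmod_mult, Cmod_R, Rabs_right by (unfold L in *; lra).
    reflexivity. }
  assert (Hw : r * L <= r / N) by (apply Rmult_le_compat_l; lra).
  assert (Hw2 : r / N <= 1 / 2).
  { apply Rmult_le_reg_r with N; [lra|].
    unfold Rdiv; rewrite Rmult_assoc, Rinv_l; lra. }
  assert (Hexp := Cexp_quadratic (Cmult z (ln (N + 1) - ln N))).
  rewrite ML in Hexp; specialize (Hexp ltac:(lra)).
  assert (Hden : (N + 1) / 2 <= Cmod (Cplus z (RtoC (N + 1)))).
  { assert (T := Cmod_triangle (Cplus z (RtoC (N + 1))) (Copp z)).
    replace (Cplus (Cplus z (RtoC (N + 1))) (Copp z)) with (RtoC (N + 1)) in T by ring.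
    rewrite Cmod_opp, Cmod_R, Rabs_right in T by lra.
    fold r in T; lra. }
  assert (Hnz : Cplus z (RtoC (N + 1)) <> 0).
  { intros F; rewrite F, Cmod_0 in Hden; lra. }
  set (w := Cmult z (ln (N + 1) - ln N)) in *.
  replace (Cminus (Cdiv (Cmult (RtoC (N + 1)) (Cexp w)) (Cplus z (RtoC (N + 1)))) 1)
    with (Cdiv (Cplus (Cmult (RtoC (N + 1)) (Cminus (Cexp w) (Cplus 1 w)))
                      (Cmult z (RtoC ((N + 1) * L - 1))))
               (Cplus z (RtoC (N + 1)))).
  2:{ unfold w, L; rewrite !RtoC_minus, RtoC_mult, RtoC_minus; field; exact Hnz. }
  rewrite Cmod_div by exact Hnz.
  apply Rmult_le_reg_r with (Cmod (Cplus z (RtoC (N + 1)))); [lra|].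
  unfold Rdiv; rewrite Rmult_assoc, Rinv_l, Rmult_1_r by lra.
  assert (Hd : / N - / (N + 1) = / N * / (N + 1)) by (field; lra).
  rewrite Hd.
  apply Rle_trans with ((32 * r ^ 2 + 4 * r) * (/ N * / (N + 1)) * ((N + 1) / 2)).
  2:{ apply Rmult_le_compat_l; [|exact Hden].
      apply Rmult_le_pos; [nra|]; apply Rmult_le_pos; lra. }
  replace ((32 * r ^ 2 + 4 * r) * (/ N * / (N + 1)) * ((N + 1) / 2))
    with ((16 * r ^ 2 + 2 * r) * / N) by (field; lra).
  eapply Rle_trans; [apply Cmod_triangle|].
  rewrite !Cmod_mult, !Cmod_R; fold r.
  rewrite (Rabs_right (N + 1)) by lra.
  assert (A1 : Rabs ((N + 1) * L - 1) <= / N).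
  { assert (B1 : (N + 1) * / (N + 1) <= (N + 1) * L) by (apply Rmult_le_compat_l; lra).
    assert (B2 : (N + 1) * L <= (N + 1) * / N) by (apply Rmult_le_compat_l; lra).
    rewrite Rinv_r in B1 by lra.
    replace ((N + 1) * / N) with (1 + / N) in B2 by (field; lra).
    apply Rabs_le; lra. }
  assert (A2 : (N + 1) * Cmod (Cminus (Cexp w) (Cplus 1 w)) <= 16 * r ^ 2 * / N).
  { apply Rle_trans with ((2 * N) * (8 * (r / N) ^ 2)).
    - apply Rmult_le_compat; [lra|apply Cmod_ge_0|lra|].
      eapply Rle_trans; [exact Hexp|].
      apply Rmult_le_compat_l; [lra|].
      apply pow_incr; split; [|exact Hw].
      apply Rmult_le_pos; lra.
    - right; field; lra. }
  assert (A3 : r * Rabs ((N + 1) * L - 1) <= r * / N)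
    by (apply Rmult_le_compat_l; lra).
  nra.
Qed.

Lemma euler_gauss_cauchy (z : C) : ~ Gamma_pole z ->
  exists (N : nat) (B : R), forall n m, (N <= n)%nat -> (n <= m)%nat ->
    Cmod (Cminus (euler_gauss z m) (euler_gauss z n)) <= B * / INR n.
Proof.
  intros Hz.
  destruct (nfloor_ex (2 * Cmod z)) as [N0 HN0].
  { assert (H := Cmod_ge_0 z); lra. }
  set (N := S N0).
  set (K := 32 * Cmod z ^ 2 + 4 * Cmod z).
  assert (HK : 0 <= K) by (assert (H := Cmod_ge_0 z); unfold K; nra).
  set (u := euler_gauss z).
  assert (Hbig : forall n, (N <= n)%nat -> 2 * Cmod z <= INR n).
  { intros n Hn; apply le_INR in Hn; unfold N in Hn; rewrite S_INR in Hn; lra. }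
  assert (Hinv : forall n, (N <= n)%nat -> 0 < / INR (S n) /\ / INR (S n) <= / INR n).
  { intros n Hn.
    assert (0 < INR n) by (apply lt_0_INR; unfold N in Hn; lia).
    rewrite S_INR; split; [apply Rinv_0_lt_compat; lra|].
    apply Rinv_le_contravar; lra. }
  assert (Hstep : forall n, (N <= n)%nat ->
    Cmod (Cminus (u (S n)) (u n)) <= Cmod (u n) * (K * (/ INR n - / INR (S n)))).
  { intros n Hn.
    unfold u; rewrite euler_gauss_S by (auto; unfold N in Hn; lia).
    set (q := Cdiv _ _).
    replace (Cminus (Cmult (euler_gauss z n) q) (euler_gauss z n))
      with (Cmult (euler_gauss z n) (Cminus q 1)) by ring.
    rewrite Cmod_mult; apply Rmult_le_compat_l; [apply Cmod_ge_0|].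
    apply euler_gauss_ratio; [unfold N in Hn; lia|now apply Hbig]. }
  assert (Hbd : forall k,
    Cmod (u (N + k)%nat) <= Cmod (u N) * exp (K * (/ INR N - / INR (N + k)))).
  { induction k as [|k IH].
    - rewrite Nat.add_0_r, Rminus_diag, Rmult_0_r, exp_0; lra.
    - rewrite Nat.add_succ_r; set (n := (N + k)%nat) in *.
      assert (Hn : (N <= n)%nat) by (unfold n; lia).
      assert (S1 := Hstep n Hn); assert (I := Hinv n Hn).
      assert (T := Cmod_triangle (Cminus (u (S n)) (u n)) (u n)).
      replace (Cplus (Cminus (u (S n)) (u n)) (u n)) with (u (S n)) in T by ring.
      set (d := K * (/ INR n - / INR (S n))) in *.
      replace (K * (/ INR N - / INR (S n)))
        with (K * (/ INR N - / INR n) + d) by (unfold d; ring).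
      rewrite exp_plus, <- Rmult_assoc.
      apply Rle_trans with (Cmod (u n) * exp d).
      + assert (E := exp_ineq1_le d); assert (P := Cmod_ge_0 (u n)); nra.
      + apply Rmult_le_compat_r; [left; apply exp_pos|exact IH]. }
  set (M := Cmod (u N) * exp (K * / INR N)).
  assert (HM : forall n, (N <= n)%nat -> Cmod (u n) <= M).
  { intros n Hn; replace n with (N + (n - N))%nat by lia.
    eapply Rle_trans; [apply Hbd|].
    apply Rmult_le_compat_l; [apply Cmod_ge_0|].
    apply exp_le_mono.
    apply Rmult_le_compat_l; [exact HK|].
    assert (0 < / INR (N + (n - N))); [|lra].
    apply Rinv_0_lt_compat, lt_0_INR; unfold N; lia. }
  assert (HM0 : 0 <= M) by (eapply Rle_trans; [apply Cmod_ge_0|apply (HM N); lia]).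
  exists N, (M * K); intros n m Hn Hm.
  assert (Htel : Cmod (Cminus (u m) (u n)) <= M * K * (/ INR n - / INR m)).
  { induction Hm as [|m Hm IH].
    - replace (Cminus (u n) (u n)) with (RtoC 0) by ring.
      rewrite Cmod_0; lra.
    - assert (S1 := Hstep m ltac:(lia)); assert (I := Hinv m ltac:(lia)).
      assert (S2 := HM m ltac:(lia)).
      assert (T := Cmod_triangle (Cminus (u (S m)) (u m)) (Cminus (u m) (u n))).
      replace (Cplus (Cminus (u (S m)) (u m)) (Cminus (u m) (u n)))
        with (Cminus (u (S m)) (u n)) in T by ring.
      assert (S3 : Cmod (u m) * (K * (/ INR m - / INR (S m)))
                   <= M * (K * (/ INR m - / INR (S m)))).
      { apply Rmult_le_compat_r; [|exact S2].
        apply Rmult_le_pos; lra. }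
      lra. }
  fold u; eapply Rle_trans; [exact Htel|].
  apply Rmult_le_compat_l; [apply Rmult_le_pos; assumption|].
  assert (0 < / INR m); [|lra].
  apply Rinv_0_lt_compat, lt_0_INR; unfold N in Hn; lia.
Qed.

Lemma ex_lim_seq_of_rate (v : nat -> R) (N : nat) (B : R) :
  (forall n m, (N <= n)%nat -> (n <= m)%nat -> Rabs (v m - v n) <= B * / INR n) ->
  ex_finite_lim_seq v.
Proof.
  intros H; apply ex_lim_seq_cauchy_corr; intros eps.
  destruct (nfloor_ex (Rabs B / eps)) as [k Hk].
  { apply Rdiv_le_0_compat; [apply Rabs_pos|apply cond_pos]. }
  assert (He := cond_pos eps).
  exists (max N (S k)).
  assert (W : forall n m, (max N (S k) <= n)%nat -> (n <= m)%nat ->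
    Rabs (v m - v n) < eps).
  { intros n m Hn Hm.
    eapply Rle_lt_trans; [apply H; [lia|exact Hm]|].
    assert (Hn' : INR (S k) <= INR n) by (apply le_INR; lia).
    rewrite S_INR in Hn'.
    assert (P : 0 < INR n) by (assert (Q := pos_INR k); lra).
    apply Rmult_lt_reg_r with (INR n); [exact P|].
    rewrite Rmult_assoc, Rinv_l, Rmult_1_r by lra.
    assert (Q : Rabs B < eps * INR n).
    { replace (Rabs B) with (eps * (Rabs B / eps)) by (field; lra).
      apply Rmult_lt_compat_l; lra. }
    assert (Q2 := Rle_abs B); lra. }
  intros n m Hn Hm; destruct (Nat.le_ge_cases n m).
  - rewrite Rabs_minus_sym; now apply W.
  - now apply W.
Qed.

Lemma Gamma_is_lim (z : C) : ~ Gamma_pole z ->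
  is_lim_seq (fun n => Re (euler_gauss z n)) (Re (Gamma z)) /\
  is_lim_seq (fun n => Im (euler_gauss z n)) (Im (Gamma z)).
Proof.
  intros Hz; destruct (euler_gauss_cauchy z Hz) as [N [B H]].
  split; apply Lim_seq_correct', (ex_lim_seq_of_rate _ N B);
    intros n m Hn Hm; refine (Rle_trans _ _ _ _ (H n m Hn Hm)).
  - exact (re_le_Cmod (Cminus (euler_gauss z m) (euler_gauss z n))).
  - exact (im_le_Cmod (Cminus (euler_gauss z m) (euler_gauss z n))).
Qed.

Lemma is_lim_seq_ratio (c : R) : is_lim_seq (fun n => INR n / (INR n + c)) 1.
Proof.
  apply is_lim_seq_ext_loc with (fun n => / (1 + c * / INR n)).
  { destruct (nfloor_ex (Rabs c)) as [k Hk]; [apply Rabs_pos|].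
    exists (S k); intros n Hn; apply le_INR in Hn; rewrite S_INR in Hn.
    assert (Q := pos_INR k).
    field; split; [|lra].
    split_Rabs; lra. }
  replace (Finite 1) with (Rbar_inv (Finite (1 + c * 0)))
    by (simpl; f_equal; field; lra).
  apply is_lim_seq_inv.
  - apply (is_lim_seq_plus' _ _ 1 (c * 0)); [apply is_lim_seq_const|].
    apply (is_lim_seq_mult' _ _ c 0); [apply is_lim_seq_const|].
    replace (Finite 0) with (Rbar_inv p_infty) by reflexivity.
    apply is_lim_seq_inv; [apply is_lim_seq_INR|discriminate].
  - intros F; injection F; lra.
Qed.

Lemma Gamma_1 : Gamma 1 = 1.
Proof.
  assert (R1 : forall n, rising 1 n = RtoC (INR (fact n))).
  { induction n as [|n IH]; [reflexivity|].
    change (rising 1 (S n)) with (Cmult (rising 1 n) (Cplus 1 (INR n))).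
    change (fact (S n)) with (S n * fact n)%nat.
    rewrite IH, mult_INR, S_INR, RtoC_mult, RtoC_plus; ring. }
  assert (E : forall n, (1 <= n)%nat -> euler_gauss 1 n = RtoC (INR n / (INR n + 1))).
  { intros n Hn; unfold euler_gauss; rewrite R1.
    assert (P : 0 < INR n) by (apply lt_0_INR; lia).
    replace (Cexp (Cmult 1 (ln (INR n)))) with (RtoC (INR n)).
    2:{ unfold Cexp, Cmult, RtoC; simpl.
        replace (1 * 0 + 0 * ln (INR n)) with 0 by ring.
        replace (1 * ln (INR n) - 0 * 0) with (ln (INR n)) by ring.
        rewrite cos_0, sin_0, exp_ln by lra; f_equal; ring. }
    assert (F := INR_fact_neq_0 n).
    change (fact (S n)) with (S n * fact n)%nat.
    rewrite <- RtoC_mult, mult_INR, S_INR, <- RtoC_div.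
    - f_equal; field; split; lra.
    - apply Rmult_integral_contrapositive_currified; lra. }
  unfold Gamma; rewrite (is_lim_seq_unique _ (Finite 1)), (is_lim_seq_unique _ (Finite 0)).
  - reflexivity.
  - apply is_lim_seq_ext_loc with (fun _ => 0); [|apply is_lim_seq_const].
    exists 1%nat; intros n Hn; rewrite E by exact Hn; reflexivity.
  - apply is_lim_seq_ext_loc with (fun n => INR n / (INR n + 1)); [|apply is_lim_seq_ratio].
    exists 1%nat; intros n Hn; rewrite E by exact Hn; reflexivity.
Qed.

Lemma Gamma_succ (z : C) : ~ Gamma_pole z ->
  Gamma (Cplus z 1) = Cmult z (Gamma z).
Proof.
  intros Hz.
  assert (Hz1 : ~ Gamma_pole (Cplus z 1)).
  { intros [n E]; apply Hz; exists (S n).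
    replace z with (Cminus (Cplus z 1) 1) by ring.
    rewrite E, S_INR, RtoC_plus; ring. }
  assert (Hr : forall n,
    Cmult z (rising (Cplus z 1) n) = rising z (S n)).
  { induction n as [|n IH]; [simpl; ring|].
    change (rising z (S (S n))) with (Cmult (rising z (S n)) (Cplus z (INR (S n)))).
    rewrite <- IH, S_INR, RtoC_plus; simpl; ring. }
  assert (E : forall n, (1 <= n)%nat ->
    Cmult z (euler_gauss z n) =
    Cplus (euler_gauss (Cplus z 1) n)
          (Cmult (RtoC (/ INR n)) (Cmult (Cplus z 1) (euler_gauss (Cplus z 1) n)))).
  { intros n Hn.
    assert (P : 0 < INR n) by (apply lt_0_INR; lia).
    assert (P' : RtoC (INR n) <> 0) by (intros F; injection F; lra).
    assert (R1 := rising_neq_0 _ (S n) Hz1).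
    assert (R2 := rising_neq_0 _ (S n) Hz).
    unfold euler_gauss.
    replace (Cexp (Cmult (Cplus z 1) (ln (INR n))))
      with (Cmult (RtoC (INR n)) (Cexp (Cmult z (ln (INR n))))).
    2:{ replace (Cmult (Cplus z 1) (ln (INR n)))
          with (Cplus (RtoC (ln (INR n))) (Cmult z (ln (INR n)))) by ring.
        rewrite Cexp_plus; f_equal.
        unfold Cexp, RtoC; simpl.
        rewrite cos_0, sin_0, exp_ln by lra; f_equal; ring. }
    assert (R3 : rising (Cplus z 1) (S n) =
      Cmult (rising (Cplus z 1) n) (Cplus (Cplus z 1) (INR n))) by reflexivity.
    rewrite <- (Hr n) in R2 |- *.
    rewrite R3 in R1 |- *.
    rewrite RtoC_inv by lra.
    assert (Q1 : z <> 0) by (intros F; apply R2; rewrite F; ring).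
    assert (Q2 : rising (Cplus z 1) n <> 0) by (intros F; apply R2; rewrite F; ring).
    assert (Q3 : Cplus (Cplus z 1) (INR n) <> 0) by (intros F; apply R1; rewrite F; ring).
    field; repeat split; assumption. }
  destruct (Gamma_is_lim _ Hz) as [A1 A2].
  destruct (Gamma_is_lim _ Hz1) as [B1 B2].
  set (u := euler_gauss z) in *; set (v := euler_gauss (Cplus z 1)) in *.
  assert (I0 : is_lim_seq (fun n => / INR n) 0).
  { change (Finite 0) with (Rbar_inv p_infty).
    apply is_lim_seq_inv; [apply is_lim_seq_INR|discriminate]. }
  destruct z as [a b].
  assert (C1 : is_lim_seq
    (fun n => Re (v n) + / INR n * ((a + 1) * Re (v n) - (b + 0) * Im (v n)))
    (Re (Gamma (Cplus (a, b) 1)) + 0 * ((a + 1) * Re (Gamma (Cplus (a, b) 1))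
      - (b + 0) * Im (Gamma (Cplus (a, b) 1))))).
  { apply is_lim_seq_plus'; [exact B1|].
    apply is_lim_seq_mult'; [exact I0|].
    apply is_lim_seq_minus'; apply is_lim_seq_mult'; auto using is_lim_seq_const. }
  assert (C2 : is_lim_seq
    (fun n => Im (v n) + / INR n * ((a + 1) * Im (v n) + (b + 0) * Re (v n)))
    (Im (Gamma (Cplus (a, b) 1)) + 0 * ((a + 1) * Im (Gamma (Cplus (a, b) 1))
      + (b + 0) * Re (Gamma (Cplus (a, b) 1))))).
  { apply is_lim_seq_plus'; [exact B2|].
    apply is_lim_seq_mult'; [exact I0|].
    apply is_lim_seq_plus'; apply is_lim_seq_mult'; auto using is_lim_seq_const. }
  assert (D1 : is_lim_seq (fun n => a * Re (u n) - b * Im (u n))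
    (a * Re (Gamma (a, b)) - b * Im (Gamma (a, b)))).
  { apply is_lim_seq_minus'; apply is_lim_seq_mult'; auto using is_lim_seq_const. }
  assert (D2 : is_lim_seq (fun n => a * Im (u n) + b * Re (u n))
    (a * Im (Gamma (a, b)) + b * Re (Gamma (a, b)))).
  { apply is_lim_seq_plus'; apply is_lim_seq_mult'; auto using is_lim_seq_const. }
  apply is_lim_seq_unique in D1; apply is_lim_seq_unique in D2.
  rewrite (Lim_seq_ext_loc _ (fun n =>
    Re (v n) + / INR n * ((a + 1) * Re (v n) - (b + 0) * Im (v n)))) in D1.
  2:{ exists 1%nat; intros n Hn; specialize (E n Hn).
      apply (f_equal Re) in E.
      unfold Cmult, Cplus, RtoC, Re, Im in *; cbn [fst snd] in *; lra. }
  rewrite (Lim_seq_ext_loc _ (fun n =>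
    Im (v n) + / INR n * ((a + 1) * Im (v n) + (b + 0) * Re (v n)))) in D2.
  2:{ exists 1%nat; intros n Hn; specialize (E n Hn).
      apply (f_equal Im) in E.
      unfold Cmult, Cplus, RtoC, Re, Im in *; cbn [fst snd] in *; lra. }
  rewrite (is_lim_seq_unique _ _ C1) in D1; apply (f_equal real) in D1; cbn [real] in D1.
  rewrite (is_lim_seq_unique _ _ C2) in D2; apply (f_equal real) in D2; cbn [real] in D2.
  apply injective_projections.
  - change (Re (Gamma (Cplus (a, b) 1)) = a * Re (Gamma (a, b)) - b * Im (Gamma (a, b))).
    lra.
  - change (Im (Gamma (Cplus (a, b) 1)) = a * Im (Gamma (a, b)) + b * Re (Gamma (a, b))).
    lra.
Qed.

(* Main.v *)
Require Import Defs.
From Stdlib Require Import Reals Factorial Lra Lia.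
From Coquelicot Require Import Coquelicot.
Open Scope R_scope.

(* Put a = alpha / 2, z = x + i y and I_q(z) = int_0^(PI/2) cos (2 z t) cos(t)^q dt.
   Two integrations by parts give (q^2 - 4 z^2) I_q(z) = q (q - 1) I_(q-2)(z), so
   that, with w_k = a + k,
     I_(2a-2)(z) / I_(2a-2)(i y)
       = prod_(k < n) (w_k^2 - z^2) / (w_k^2 + y^2) * I_(2w_n-2)(z) / I_(2w_n-2)(i y).
   The last quotient tends to 1 because cos^q concentrates at 0, and by the
   Euler-Gauss limit the modulus of the product tends to
   |Gamma(a + i y)|^2 / |Gamma(a + z) Gamma(a - z)|.  The claim is therefore
   |I_(2a-2)(z)| < I_(2a-2)(i y), which is the triangle inequality under the
   integral since |cos (2 z t)| <= cosh (2 y t); the integral converges precisely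
   because 2 a - 2 > -1. *)

(** * Truncated cosine integrals and their convergence for nonnegative exponents *)

Definition trunc (n : nat) : R := PI / 2 - / (INR n + 1).

(* The truncation avoids the endpoint PI / 2, where the integrand is singular for
   q < 0 and where Stdlib's [Rpower 0 q] is 1. *)
Definition cosint (q : R) (f : R -> R) (n : nat) : R :=
  RInt (fun t => f t * Rpower (cos t) q) 0 (trunc n).

Lemma trunc_bounds (n : nat) : PI / 2 - 1 <= trunc n < PI / 2.
Proof.
  unfold trunc; assert (P := pos_INR n).
  assert (0 < / (INR n + 1)) by (apply Rinv_0_lt_compat; lra).
  assert (/ (INR n + 1) <= / 1) by (apply Rinv_le_contravar; lra).
  lra.
Qed.

Lemma cos_pos_trunc (n : nat) (t : R) : 0 <= t <= trunc n -> 0 < cos t <= 1.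
Proof.
  intros Ht; assert (B := trunc_bounds n).
  split; [apply cos_gt_0; lra|apply COS_bound].
Qed.

Lemma trunc_pos (n : nat) : 0 < trunc n.
Proof. assert (B := trunc_bounds n); assert (P := PI2_1); lra. Qed.

Lemma is_lim_trunc : is_lim_seq trunc (PI / 2).
Proof.
  unfold trunc.
  replace (Finite (PI / 2)) with (Finite (PI / 2 - 0)) by (f_equal; ring).
  apply is_lim_seq_minus'; [apply is_lim_seq_const|].
  change (Finite 0) with (Rbar_inv p_infty).
  apply is_lim_seq_inv; [|discriminate].
  apply is_lim_seq_ext with (fun n => INR (S n)); [intros; apply S_INR|].
  apply -> (is_lim_seq_incr_1 INR); apply is_lim_seq_INR.
Qed.

Lemma is_derive_Rpower_cos (q t : R) : 0 < cos t ->
  is_derive (fun s => Rpower (cos s) q) t (- q * sin t * Rpower (cos t) (q - 1)).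
Proof.
  intros H.
  replace (Rpower (cos t) (q - 1)) with (Rpower (cos t) q * / cos t).
  2:{ unfold Rminus; rewrite Rpower_plus, Rpower_Ropp, Rpower_1 by lra; reflexivity. }
  unfold Rpower; auto_derive; [lra|field; lra].
Qed.

Lemma continuous_cosint (q : R) (f : R -> R) (t : R) :
  (forall s, continuous f s) -> 0 < cos t ->
  continuous (fun s => f s * Rpower (cos s) q) t.
Proof.
  intros Hf Hc; apply (continuous_mult f); [apply Hf|].
  apply (ex_derive_continuous (fun s => Rpower (cos s) q)).
  eexists; now apply is_derive_Rpower_cos.
Qed.

Lemma ex_cosint (q : R) (f : R -> R) (a b : R) :
  (forall s, continuous f s) -> 0 <= a -> a <= b -> b < PI / 2 ->
  ex_RInt (fun s => f s * Rpower (cos s) q) a b.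
Proof.
  intros Hf Ha Hab Hb; apply (ex_RInt_continuous (V := R_CompleteNormedModule)).
  intros t; rewrite Rmin_left, Rmax_right by lra; intros Ht.
  apply continuous_cosint; [exact Hf|apply cos_gt_0; lra].
Qed.

Lemma Rpower_le_1 (c q : R) : 0 < c <= 1 -> 0 <= q -> Rpower c q <= 1.
Proof.
  intros Hc Hq; unfold Rpower; rewrite <- exp_0; apply exp_le_mono.
  assert (ln c <= 0).
  { rewrite <- ln_1; destruct (Req_dec c 1) as [->|]; [lra|].
    left; apply ln_increasing; lra. }
  nra.
Qed.

(** For [q >= 0] the weight is at most 1, so the piece between two truncation points is O(1/n) and
    the sequence is Cauchy. Exponents in (-1, 0) are reached later through the recurrence. *)
Lemma cosint_converges (q : R) (f : R -> R) :
  (forall s, continuous f s) -> 0 <= q -> ex_finite_lim_seq (cosint q f).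
Proof.
  intros Hf Hq.
  destruct (continuity_ab_maj (fun t => Rabs (f t)) 0 (PI / 2)) as [m [Hm _]].
  { assert (P := PI2_1); lra. }
  { intros c _; apply continuity_pt_filterlim.
    apply (continuous_comp f Rabs); [apply Hf|apply continuous_Rabs]. }
  set (M := Rabs (f m)) in *.
  assert (HM : 0 <= M) by apply Rabs_pos.
  apply (ex_lim_seq_of_rate _ 1 M); intros n k Hn Hk; unfold cosint.
  assert (Bn := trunc_bounds n); assert (Bk := trunc_bounds k).
  assert (Pn := trunc_pos n); assert (Pk := trunc_pos k).
  assert (INR 1 <= INR n) by (now apply le_INR); simpl in H.
  assert (INR n <= INR k) by (now apply le_INR).
  assert (L : trunc n <= trunc k).
  { unfold trunc; assert (/ (INR k + 1) <= / (INR n + 1));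
      [apply Rinv_le_contravar; lra|lra]. }
  rewrite <- (RInt_Chasles _ 0 (trunc n) (trunc k)) by (apply ex_cosint; auto; lra).
  match goal with |- Rabs (plus ?A ?B - _) <= _ =>
    replace (plus A B - A) with B by exact (eq_sym (Rplus_minus_l A B)) end.
  eapply Rle_trans; [apply abs_RInt_le_const with (M := M); [exact L| |]|].
  - apply ex_cosint; auto; lra.
  - intros t Ht.
    assert (C := cos_pos_trunc k t ltac:(lra)).
    rewrite Rabs_mult, (Rabs_right (Rpower _ _)) by (left; apply exp_pos).
    assert (R1 := Rpower_le_1 (cos t) q C Hq).
    assert (R2 := Hm t ltac:(lra)); simpl in R2.
    assert (R3 : 0 < Rpower (cos t) q) by apply exp_pos.
    assert (R4 := Rabs_pos (f t)); nra.
  - rewrite Rmult_comm; apply Rmult_le_compat_l; [exact HM|].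
    unfold trunc.
    assert (/ (INR n + 1) <= / INR n) by (apply Rinv_le_contravar; lra).
    assert (0 < / (INR k + 1)) by (apply Rinv_0_lt_compat; lra).
    lra.
Qed.

(** * Integration by parts and the recurrence in the exponent *)

Lemma is_lim_Rpower_cos_trunc (p : R) : 0 < p ->
  is_lim_seq (fun n => Rpower (cos (trunc n)) p) 0.
Proof.
  intros Hp; unfold Rpower.
  assert (C0 : is_lim_seq (fun n => cos (trunc n)) 0).
  { rewrite <- cos_PI2; apply is_lim_seq_continuous; [|apply is_lim_trunc].
    apply continuity_cos. }
  assert (L : is_lim_seq (fun n => ln (cos (trunc n))) m_infty).
  { eapply filterlim_comp; [|apply is_lim_ln_0].
    intros P [e He].
    destruct (proj2 (is_lim_seq_spec _ _) C0 e) as [N HN].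
    exists N; intros n Hn; apply He.
    - apply HN; exact Hn.
    - apply (cos_pos_trunc n); assert (T := trunc_pos n); lra. }
  apply (is_lim_seq_scal_l _ p) in L.
  replace (Rbar_mult p m_infty) with m_infty in L.
  2:{ symmetry; apply is_Rbar_mult_unique; unfold is_Rbar_mult; simpl.
      destruct (Rle_dec 0 p) as [h|]; [|lra].
      destruct (Rle_lt_or_eq_dec 0 p h); [reflexivity|lra]. }
  eapply filterlim_comp; [exact L|apply is_lim_exp_m].
Qed.

Lemma Rpower_succ (c q : R) : 0 < c -> Rpower c (q + 1) = c * Rpower c q.
Proof. intros Hc; rewrite Rpower_plus, Rpower_1 by exact Hc; ring. Qed.

Lemma cosint_linear (q a b : R) (f g : R -> R) (n : nat) :
  (forall s, continuous f s) -> (forall s, continuous g s) ->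
  cosint q (fun t => a * f t + b * g t) n = a * cosint q f n + b * cosint q g n.
Proof.
  intros Hf Hg; unfold cosint.
  assert (B := trunc_bounds n); assert (P := trunc_pos n).
  apply is_RInt_unique.
  apply is_RInt_ext with (fun t => plus (scal a (f t * Rpower (cos t) q))
                                        (scal b (g t * Rpower (cos t) q))).
  { intros t _; unfold plus, scal; simpl; unfold mult; simpl; ring. }
  apply (is_RInt_plus (V := R_NormedModule)); apply (is_RInt_scal (V := R_NormedModule));
    apply (RInt_correct (V := R_CompleteNormedModule)); apply ex_cosint; auto; lra.
Qed.

(* Integration of f'' g - f g'' = (f' g - f g')' with g = cos^q; the boundary term
   at PI / 2 vanishes because q > 1. *)
Lemma is_lim_cosint_sub_2 (q l l2 : R) (f f1 f2 : R -> R) :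
  (forall t, is_derive f t (f1 t)) -> (forall t, is_derive f1 t (f2 t)) ->
  (forall t, continuous f2 t) -> f1 0 = 0 -> 1 < q ->
  is_lim_seq (cosint q f) l -> is_lim_seq (cosint q f2) l2 ->
  is_lim_seq (cosint (q - 2) f) ((l2 + q ^ 2 * l) / (q * (q - 1))).
Proof.
  intros D1 D2 C2 F0 Hq L L2.
  assert (Cf : forall t, continuous f t)
    by (intros t; apply (ex_derive_continuous f); eexists; apply D1).
  assert (Cf1 : forall t, continuous f1 t)
    by (intros t; apply (ex_derive_continuous f1); eexists; apply D2).
  (* [G] is f' g - f g', because g' = - q sin cos^(q-1). *)
  set (G := fun t => f1 t * Rpower (cos t) q
                     + q * (f t * sin t * Rpower (cos t) (q - 1))).
  assert (E : forall n, cosint (q - 2) f n =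
    (cosint q f2 n + q ^ 2 * cosint q f n - G (trunc n)) / (q * (q - 1))).
  { intros n.
    assert (B := trunc_bounds n); assert (P := trunc_pos n).
    (* The integrand is f'' g - f g'' with g'' = q (q - 1) cos^(q-2) - q^2 cos^q, after sin^2 = 1 -
       cos^2. *)
    assert (I : is_RInt (fun t => (f2 t * Rpower (cos t) q
        + q ^ 2 * (f t * Rpower (cos t) q))
        - q * (q - 1) * (f t * Rpower (cos t) (q - 2))) 0 (trunc n)
        (minus (G (trunc n)) (G 0))).
    { apply (is_RInt_derive (V := R_CompleteNormedModule)).
      - intros t; rewrite Rmin_left, Rmax_right by lra; intros Ht.
        assert (C := cos_pos_trunc n t Ht).
        assert (R1 : Rpower (cos t) (q - 1) = cos t * Rpower (cos t) (q - 2)).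
        { rewrite <- Rpower_succ by lra; f_equal; ring. }
        assert (R0 : Rpower (cos t) q = cos t ^ 2 * Rpower (cos t) (q - 2)).
        { replace q with (q - 1 + 1) at 1 by ring.
          rewrite Rpower_succ, R1 by lra; ring. }
        assert (S2 := sin2_cos2 t); unfold Rsqr in S2.
        assert (X1 := is_derive_Rpower_cos q t (proj1 C)).
        assert (X2 := is_derive_Rpower_cos (q - 1) t (proj1 C)).
        assert (X3 : is_derive sin t (cos t)) by (auto_derive; [trivial|ring]).
        replace (q - 1 - 1) with (q - 2) in X2 by ring.
        evar_last.
        { apply (is_derive_plus (V := R_NormedModule)).
          - apply (is_derive_mult f1); [apply D2|exact X1|exact Rmult_comm].
          - apply (is_derive_scal (fun s => f s * sin s * Rpower (cos s) (q - 1))).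
            apply (is_derive_mult (fun s => f s * sin s));
              [apply (is_derive_mult f); [apply D1|exact X3|exact Rmult_comm]
              |exact X2|exact Rmult_comm]. }
        unfold plus, mult, scal; simpl; unfold mult; simpl.
        rewrite R0, R1; set (r := Rpower (cos t) (q - 2)).
        transitivity (f2 t * (cos t ^ 2 * r) + q * f t * r * (cos t ^ 2)
                      - q * (q - 1) * f t * r * (sin t * sin t)); [ring|].
        replace (sin t * sin t) with (1 - cos t * cos t) by lra; ring.
      - intros t; rewrite Rmin_left, Rmax_right by lra; intros Ht.
        assert (C := cos_pos_trunc n t Ht).
        apply (continuous_minus (V := R_NormedModule)
          (fun t => f2 t * Rpower (cos t) q + q ^ 2 * (f t * Rpower (cos t) q))).
        + apply (continuous_plus (V := R_NormedModule) (fun t => f2 t * Rpower (cos t) q));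
            [apply continuous_cosint; [exact C2|lra]|].
          apply (continuous_scal_r (V := R_NormedModule) (q ^ 2)
            (fun t => f t * Rpower (cos t) q)).
          apply continuous_cosint; [exact Cf|lra].
        + apply (continuous_scal_r (V := R_NormedModule) (q * (q - 1))
            (fun t => f t * Rpower (cos t) (q - 2))).
          apply continuous_cosint; [exact Cf|lra]. }
    assert (X : forall h p, (forall s, continuous h s) ->
      is_RInt (fun t => h t * Rpower (cos t) p) 0 (trunc n) (cosint p h n)).
    { intros h p Hh; apply (RInt_correct (V := R_CompleteNormedModule)).
      apply ex_cosint; auto; lra. }
    assert (I' := is_RInt_minus (V := R_NormedModule) _ _ _ _ _ _
      (is_RInt_plus (V := R_NormedModule) _ _ _ _ _ _ (X f2 q C2)
        (is_RInt_scal (V := R_NormedModule) _ _ _ (q ^ 2) _ (X f q Cf)))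
      (is_RInt_scal (V := R_NormedModule) _ _ _ (q * (q - 1)) _ (X f (q - 2) Cf))).
    assert (U : G (trunc n) - G 0 = cosint q f2 n + q ^ 2 * cosint q f n
                - q * (q - 1) * cosint (q - 2) f n).
    { etransitivity; [symmetry; exact (is_RInt_unique _ _ _ _ I)|].
      exact (is_RInt_unique _ _ _ _ I'). }
    (* [G 0] vanishes: [f1 0 = 0] removes its first term and sin 0 = 0 the second. *)
    unfold G in U at 2; rewrite F0, sin_0 in U.
    apply Rmult_eq_reg_r with (q * (q - 1)); [|nra].
    field_simplify; [|lra]; lra. }
  apply is_lim_seq_ext with (1 := fun n => eq_sym (E n)).
  replace (l2 + q ^ 2 * l) with (l2 + q ^ 2 * l - 0) by ring.
  unfold Rdiv; apply is_lim_seq_mult'; [|apply is_lim_seq_const].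
  apply is_lim_seq_minus'.
  - apply is_lim_seq_plus'; [exact L2|].
    apply is_lim_seq_mult'; [apply is_lim_seq_const|exact L].
  - assert (K : forall h, (forall t, continuous h t) ->
      is_lim_seq (fun n => h (trunc n)) (h (PI / 2))).
    { intros h Hh; apply is_lim_seq_continuous; [|apply is_lim_trunc].
      apply continuity_pt_filterlim, Hh. }
    replace 0 with (f1 (PI / 2) * 0 + q * (f (PI / 2) * sin (PI / 2) * 0)) by ring.
    apply is_lim_seq_plus'.
    + apply is_lim_seq_mult'; [now apply K|apply is_lim_Rpower_cos_trunc; lra].
    + apply is_lim_seq_mult'; [apply is_lim_seq_const|].
      apply is_lim_seq_mult'; [|apply is_lim_Rpower_cos_trunc; lra].
      apply is_lim_seq_mult'; [now apply K|].
      apply (K sin); intros t; apply continuous_sin.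
Qed.

(* Real and imaginary parts of cos (2 (x + i y) t). *)
Definition re_cos (x y t : R) : R := cos (2 * x * t) * cosh (2 * y * t).
Definition im_cos (x y t : R) : R := - (sin (2 * x * t) * sinh (2 * y * t)).

Definition re_cos' (x y t : R) : R :=
  - 2 * x * (sin (2 * x * t) * cosh (2 * y * t))
  + 2 * y * (cos (2 * x * t) * sinh (2 * y * t)).
Definition im_cos' (x y t : R) : R :=
  - 2 * x * (cos (2 * x * t) * sinh (2 * y * t))
  - 2 * y * (sin (2 * x * t) * cosh (2 * y * t)).

Lemma is_derive_re_cos (x y t : R) : is_derive (re_cos x y) t (re_cos' x y t).
Proof.
  unfold re_cos, re_cos', cosh, sinh; auto_derive; [trivial|field].
Qed.

Lemma is_derive_im_cos (x y t : R) : is_derive (im_cos x y) t (im_cos' x y t).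
Proof.
  unfold im_cos, im_cos', cosh, sinh; auto_derive; [trivial|field].
Qed.

(** Real part of (cos (2 z t))'' = - 4 z^2 cos (2 z t), where - 4 z^2 = 4 y^2 - 4 x^2 - 8 i x y; the
    next lemma is the imaginary part. *)
Lemma is_derive_re_cos' (x y t : R) : is_derive (re_cos' x y) t
  ((4 * y ^ 2 - 4 * x ^ 2) * re_cos x y t + 8 * x * y * im_cos x y t).
Proof.
  unfold re_cos, re_cos', im_cos, cosh, sinh; auto_derive; [trivial|field].
Qed.

Lemma is_derive_im_cos' (x y t : R) : is_derive (im_cos' x y) t
  ((4 * y ^ 2 - 4 * x ^ 2) * im_cos x y t + - (8 * x * y) * re_cos x y t).
Proof.
  unfold re_cos, im_cos', im_cos, cosh, sinh; auto_derive; [trivial|field].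
Qed.

Lemma continuous_re_cos (x y t : R) : continuous (re_cos x y) t.
Proof. apply (ex_derive_continuous (re_cos x y)); eexists; apply is_derive_re_cos. Qed.

Lemma continuous_im_cos (x y t : R) : continuous (im_cos x y) t.
Proof. apply (ex_derive_continuous (im_cos x y)); eexists; apply is_derive_im_cos. Qed.

Lemma continuous_lin_comb (f g : R -> R) (a b t : R) :
  continuous f t -> continuous g t -> continuous (fun s => a * f s + b * g s) t.
Proof.
  intros Hf Hg.
  apply (continuous_plus (V := R_NormedModule) (fun s => a * f s));
    apply (continuous_scal_r (V := R_NormedModule)); assumption.
Qed.

(* Real and imaginary parts of I_q(x + i y), where
   I_q(z) = int_0^(PI/2) cos (2 z t) cos(t)^q dt; thus I_q(i y) = Icos_re 0 y q. *)
Definition Icos_re (x y q : R) : R := real (Lim_seq (cosint q (re_cos x y))).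
Definition Icos_im (x y q : R) : R := real (Lim_seq (cosint q (im_cos x y))).

Lemma is_lim_cosint_lin_comb (q a b l m : R) (f g : R -> R) :
  (forall s, continuous f s) -> (forall s, continuous g s) ->
  is_lim_seq (cosint q f) l -> is_lim_seq (cosint q g) m ->
  is_lim_seq (cosint q (fun t => a * f t + b * g t)) (a * l + b * m).
Proof.
  intros Hf Hg L M.
  apply is_lim_seq_ext with (fun n => a * cosint q f n + b * cosint q g n).
  { intros n; symmetry; now apply cosint_linear. }
  apply is_lim_seq_plus'; apply is_lim_seq_mult'; auto using is_lim_seq_const.
Qed.

(** Since f'' = - 4 z^2 f, the parts formula becomes q (q - 1) I_(q-2) = (q^2 - 4 z^2) I_q. It is
    phrased with arbitrary limits [l] and [m] so that convergence at [q - 2] is part of the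
    conclusion. *)
Lemma is_lim_cosint_cos_sub_2 (x y q l m : R) : 1 < q ->
  is_lim_seq (cosint q (re_cos x y)) l -> is_lim_seq (cosint q (im_cos x y)) m ->
  is_lim_seq (cosint (q - 2) (re_cos x y))
    (((q ^ 2 + 4 * y ^ 2 - 4 * x ^ 2) * l + 8 * x * y * m) / (q * (q - 1))) /\
  is_lim_seq (cosint (q - 2) (im_cos x y))
    (((q ^ 2 + 4 * y ^ 2 - 4 * x ^ 2) * m - 8 * x * y * l) / (q * (q - 1))).
Proof.
  intros Hq L M; split.
  - replace ((q ^ 2 + 4 * y ^ 2 - 4 * x ^ 2) * l + 8 * x * y * m)
      with ((4 * y ^ 2 - 4 * x ^ 2) * l + 8 * x * y * m + q ^ 2 * l) by ring.
    eapply is_lim_cosint_sub_2;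
      [apply is_derive_re_cos|apply is_derive_re_cos'| | |exact Hq|exact L|].
    + intros t; apply continuous_lin_comb;
        auto using continuous_re_cos, continuous_im_cos.
    + unfold re_cos'; rewrite !Rmult_0_r, sin_0, sinh_0; ring.
    + apply is_lim_cosint_lin_comb; auto using continuous_re_cos, continuous_im_cos.
  - replace ((q ^ 2 + 4 * y ^ 2 - 4 * x ^ 2) * m - 8 * x * y * l)
      with ((4 * y ^ 2 - 4 * x ^ 2) * m + - (8 * x * y) * l + q ^ 2 * m) by ring.
    eapply is_lim_cosint_sub_2;
      [apply is_derive_im_cos|apply is_derive_im_cos'| | |exact Hq|exact M|].
    + intros t; apply continuous_lin_comb;
        auto using continuous_re_cos, continuous_im_cos.
    + unfold im_cos'; rewrite !Rmult_0_r, sin_0, sinh_0; ring.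
    + apply is_lim_cosint_lin_comb; auto using continuous_re_cos, continuous_im_cos.
Qed.

(** At exponent [q + 2] the integrals converge by boundedness; one step of the recurrence carries
    convergence down to [q], where the weight may be unbounded. *)
Lemma is_lim_Icos (x y q : R) : -1 < q ->
  is_lim_seq (cosint q (re_cos x y)) (Icos_re x y q) /\
  is_lim_seq (cosint q (im_cos x y)) (Icos_im x y q).
Proof.
  intros Hq.
  destruct (cosint_converges (q + 2) (re_cos x y)) as [l L];
    [apply continuous_re_cos|lra|].
  destruct (cosint_converges (q + 2) (im_cos x y)) as [m M];
    [apply continuous_im_cos|lra|].
  destruct (is_lim_cosint_cos_sub_2 x y (q + 2) l m ltac:(lra) L M) as [A B].
  replace (q + 2 - 2) with q in A, B by ring.
  split; apply Lim_seq_correct'; eexists; [exact A|exact B].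
Qed.

Lemma Icos_rec (x y q : R) : 1 < q ->
  q * (q - 1) * Icos_re x y (q - 2) =
    (q ^ 2 + 4 * y ^ 2 - 4 * x ^ 2) * Icos_re x y q + 8 * x * y * Icos_im x y q /\
  q * (q - 1) * Icos_im x y (q - 2) =
    (q ^ 2 + 4 * y ^ 2 - 4 * x ^ 2) * Icos_im x y q - 8 * x * y * Icos_re x y q.
Proof.
  intros Hq; destruct (is_lim_Icos x y q ltac:(lra)) as [L M].
  destruct (is_lim_cosint_cos_sub_2 x y q _ _ Hq L M) as [A B].
  unfold Icos_re at 1, Icos_im at 2.
  rewrite (is_lim_seq_unique _ _ A), (is_lim_seq_unique _ _ B); simpl real.
  split; field; lra.
Qed.

Definition Icos_sqr (x y q : R) : R := Icos_re x y q ^ 2 + Icos_im x y q ^ 2.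

(** For q = 2 w the coefficient is 4 (w + z) (w - z); its squared modulus yields the factors of
    [rising] at a + z and a - z. *)
Lemma Icos_sqr_rec (x y w : R) : 1 < 2 * w ->
  (2 * w * (2 * w - 1)) ^ 2 * Icos_sqr x y (2 * w - 2) =
  16 * (((w + x) ^ 2 + y ^ 2) * ((w - x) ^ 2 + y ^ 2)) * Icos_sqr x y (2 * w).
Proof.
  intros Hw; destruct (Icos_rec x y (2 * w) Hw) as [A B].
  unfold Icos_sqr; rewrite Rmult_plus_distr_l, <- !Rpow_mult_distr, A, B; ring.
Qed.

Lemma Icos_imag_rec (y w : R) : 1 < 2 * w ->
  2 * w * (2 * w - 1) * Icos_re 0 y (2 * w - 2) =
  4 * (w ^ 2 + y ^ 2) * Icos_re 0 y (2 * w).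
Proof.
  intros Hw; rewrite (proj1 (Icos_rec 0 y (2 * w) Hw)); ring.
Qed.

(** * Strict inequality between the integrals at x + i y and at i y *)

Lemma re_cos_0_l (y t : R) : re_cos 0 y t = cosh (2 * y * t).
Proof. unfold re_cos; rewrite Rmult_0_r, Rmult_0_l, cos_0; ring. Qed.

Lemma cosh_pos (t : R) : 0 < cosh t.
Proof. unfold cosh; assert (A := exp_pos t); assert (B := exp_pos (- t)); lra. Qed.

(** The integral over [0, d] is a positive lower bound for all truncations from n = 1 on, and it
    survives the limit. *)
Lemma cosint_limit_pos (q d l : R) (f : R -> R) : 0 < d <= 1 / 2 ->
  (forall s, continuous f s) -> (forall t, 0 <= t -> 0 <= f t) ->
  (forall t, 0 < t < d -> 0 < f t) ->
  is_lim_seq (cosint q f) l -> 0 < l.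
Proof.
  intros Hd Hf H0 H1 L.
  assert (P1 := PI2_1).
  assert (Pos : forall t, 0 < Rpower (cos t) q) by (intros; apply exp_pos).
  set (h := fun t => f t * Rpower (cos t) q).
  assert (D0 : 0 < RInt h 0 d).
  { apply RInt_gt_0; [lra| |].
    - intros t Ht; apply Rmult_lt_0_compat; [now apply H1|apply Pos].
    - intros t Ht; apply continuous_cosint; [exact Hf|apply cos_gt_0; lra]. }
  apply Rlt_le_trans with (RInt h 0 d); [exact D0|].
  refine (is_lim_seq_le_loc (fun _ => RInt h 0 d) _ _ _ _ (is_lim_seq_const _) L).
  exists 1%nat; intros n Hn; unfold cosint; fold h.
  assert (B := trunc_bounds n).
  (* For n >= 1 the truncation point is at least PI / 2 - 1 / 2 > 1 / 2 >= d. *)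
  assert (T : d <= trunc n).
  { unfold trunc; assert (INR 1 <= INR n) by (now apply le_INR); simpl in H.
    assert (/ (INR n + 1) <= / 2) by (apply Rinv_le_contravar; lra); lra. }
  rewrite <- (RInt_Chasles h 0 d (trunc n)) by (apply ex_cosint; auto; lra).
  assert (0 <= RInt h d (trunc n)).
  { apply RInt_ge_0; [exact T|apply ex_cosint; auto; lra|].
    intros t Ht; apply Rmult_le_pos; [apply H0; lra|left; apply Pos]. }
  unfold plus; simpl; lra.
Qed.

Lemma Icos_imag_pos (y q : R) : -1 < q -> 0 < Icos_re 0 y q.
Proof.
  intros Hq; apply (cosint_limit_pos q (1 / 2) _ (re_cos 0 y)); [lra| | | |].
  - apply continuous_re_cos.
  - intros t _; rewrite re_cos_0_l; left; apply cosh_pos.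
  - intros t _; rewrite re_cos_0_l; apply cosh_pos.
  - exact (proj1 (is_lim_Icos 0 y q Hq)).
Qed.

(** Sharpens |cos (2 z t)| <= cosh (2 y t) by its exact defect, the source of strictness; it follows
    from sinh^2 = cosh^2 - 1. *)
Lemma re_im_cos_sqr (x y t : R) :
  re_cos x y t ^ 2 + im_cos x y t ^ 2 = re_cos 0 y t ^ 2 - sin (2 * x * t) ^ 2.
Proof.
  rewrite re_cos_0_l; unfold re_cos, im_cos.
  assert (S := sin2_cos2 (2 * x * t)); unfold Rsqr in S.
  assert (H : sinh (2 * y * t) ^ 2 = cosh (2 * y * t) ^ 2 - 1).
  { unfold sinh, cosh.
    assert (E : exp (2 * y * t) * exp (- (2 * y * t)) = 1)
      by (rewrite <- exp_plus, Rplus_opp_r; apply exp_0).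
    nra. }
  rewrite (Rpow_mult_distr (cos _)).
  replace ((- (sin (2 * x * t) * sinh (2 * y * t))) ^ 2)
    with (sin (2 * x * t) ^ 2 * sinh (2 * y * t) ^ 2) by ring.
  rewrite H; replace (cos (2 * x * t) ^ 2) with (1 - sin (2 * x * t) ^ 2); [ring|].
  nra.
Qed.

(** Cauchy-Schwarz in the plane, from (A u + B v)^2 + (A v - B u)^2 = (A^2 + B^2) (u^2 + v^2). *)
Lemma lin_comb_le (A B r u v w : R) : 0 <= r -> 0 <= w -> r ^ 2 = A ^ 2 + B ^ 2 ->
  u ^ 2 + v ^ 2 <= w ^ 2 -> A * u + B * v <= r * w.
Proof.
  intros Hr Hw E H.
  apply Rnot_lt_le; intros C.
  assert (0 <= r * w) by now apply Rmult_le_pos.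
  assert (C1 : (r * w) ^ 2 < (A * u + B * v) ^ 2) by nra.
  assert (C2 : (A * u + B * v) ^ 2 <= (A ^ 2 + B ^ 2) * (u ^ 2 + v ^ 2)).
  { assert (S := pow2_ge_0 (A * v - B * u)); nra. }
  rewrite <- E in C2.
  assert (r ^ 2 * (u ^ 2 + v ^ 2) <= r ^ 2 * w ^ 2)
    by (apply Rmult_le_compat_l; [apply pow2_ge_0|exact H]).
  nra.
Qed.

Lemma lin_comb_lt (A B r u v w : R) : 0 < r -> 0 <= w -> r ^ 2 = A ^ 2 + B ^ 2 ->
  u ^ 2 + v ^ 2 < w ^ 2 -> A * u + B * v < r * w.
Proof.
  intros Hr Hw E H.
  set (w' := sqrt (u ^ 2 + v ^ 2)).
  assert (P : 0 <= u ^ 2 + v ^ 2) by nra.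
  assert (W : w' ^ 2 = u ^ 2 + v ^ 2) by (apply pow2_sqrt; exact P).
  assert (W0 : 0 <= w') by apply sqrt_pos.
  assert (A * u + B * v <= r * w') by (apply lin_comb_le; lra).
  assert (w' < w) by nra.
  nra.
Qed.

(** Triangle inequality by projection: if A + i B = I_q(z) has modulus r, then r^2 is the integral
    of A [re_cos] + B [im_cos] against cos^q, and this combination is at most r cosh (2 y t),
    strictly for small t > 0. *)
Lemma Icos_sqr_lt (x y q : R) : 0 < x -> -1 < q ->
  Icos_sqr x y q < Icos_re 0 y q ^ 2.
Proof.
  intros Hx Hq.
  assert (D := Icos_imag_pos y q Hq).
  destruct (is_lim_Icos x y q Hq) as [LA LB].
  destruct (is_lim_Icos 0 y q Hq) as [LD _].
  unfold Icos_sqr.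
  set (A := Icos_re x y q) in *; set (B := Icos_im x y q) in *.
  set (D' := Icos_re 0 y q) in *.
  assert (N0 : 0 <= A ^ 2 + B ^ 2) by nra.
  set (r := sqrt (A ^ 2 + B ^ 2)).
  assert (E : r ^ 2 = A ^ 2 + B ^ 2) by (apply pow2_sqrt; exact N0).
  destruct (sqrt_pos (A ^ 2 + B ^ 2)) as [Hr|Hr]; fold r in Hr.
  2:{ rewrite <- E, <- Hr; nra. }
  assert (Wp : forall t, 0 <= re_cos 0 y t)
    by (intros; rewrite re_cos_0_l; left; apply cosh_pos).
  assert (Sq := re_im_cos_sqr x y).
  assert (K : 0 < 1 * (r * D' + - A * A) + - B * B).
  { apply (cosint_limit_pos q (Rmin (1 / 2) (/ x)) _
      (fun t => 1 * (r * re_cos 0 y t + - A * re_cos x y t) + - B * im_cos x y t)).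
    - split; [|apply Rmin_l].
      apply Rmin_glb_lt; [lra|now apply Rinv_0_lt_compat].
    - intros s; repeat apply continuous_lin_comb;
        auto using continuous_re_cos, continuous_im_cos.
    - intros t Ht.
      assert (A * re_cos x y t + B * im_cos x y t <= r * re_cos 0 y t); [|lra].
      apply lin_comb_le; [lra|apply Wp|exact E|].
      rewrite Sq; assert (S := pow2_ge_0 (sin (2 * x * t))); lra.
    - intros t Ht.
      assert (A * re_cos x y t + B * im_cos x y t < r * re_cos 0 y t); [|lra].
      apply lin_comb_lt; [lra|apply Wp|exact E|].
      assert (S : 0 < sin (2 * x * t)).
      { assert (P := PI2_1); assert (M := Rmin_r (1 / 2) (/ x)).
        assert (x * t < 1).
        { rewrite <- (Rinv_r x) by lra; apply Rmult_lt_compat_l; lra. }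
        assert (0 < x * t) by (apply Rmult_lt_0_compat; lra).
        apply sin_gt_0; lra. }
      rewrite Sq; nra.
    - apply is_lim_cosint_lin_comb; auto using continuous_im_cos.
      + intros s; apply continuous_lin_comb; auto using continuous_re_cos.
      + apply is_lim_cosint_lin_comb; auto using continuous_re_cos. }
  rewrite <- E; assert (r < D') by nra; nra.
Qed.

(** * Behaviour of the integrals for large exponents *)

Lemma sin_ge_third (t : R) : 0 <= t <= PI / 2 -> t / 3 <= sin t.
Proof.
  intros Ht; assert (P := PI_4).
  destruct (sin_bound t 0) as [H _]; [lra|lra|].
  unfold sin_approx, sin_term in H; simpl in H.
  assert (t - t ^ 3 / 6 <= sin t) by (simpl; lra).
  (* As PI <= 4, t <= 2 and so t - t^3 / 6 >= t (1 - 4 / 6) = t / 3. *)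
  assert (t ^ 2 <= 4) by nra.
  assert (t * t ^ 2 <= t * 4) by (apply Rmult_le_compat_l; lra).
  simpl in *; lra.
Qed.

(* 1 - cos (2 x t) <= 2 x^2 t^2 <= 18 x^2 sin(t)^2, and multiplying the integrand
   by sin(t)^2 = 1 - cos(t)^2 costs a factor O(1/q) by the recurrence. *)
Lemma Icos_re_lower (x y q : R) : -1 < q ->
  Icos_re 0 y q - Icos_re x y q <= 18 * x ^ 2 * (Icos_re 0 y q - Icos_re 0 y (q + 2)).
Proof.
  intros Hq.
  destruct (is_lim_Icos x y q Hq) as [LA _].
  destruct (is_lim_Icos 0 y q Hq) as [LD _].
  destruct (is_lim_Icos 0 y (q + 2) ltac:(lra)) as [LD2 _].
  assert (L1 := is_lim_seq_minus' _ _ _ _ LD LA).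
  assert (L2 := is_lim_seq_mult' _ _ _ _ (is_lim_seq_const (18 * x ^ 2))
                  (is_lim_seq_minus' _ _ _ _ LD LD2)).
  refine (is_lim_seq_le _ _ _ _ _ L1 L2).
  intros n; assert (B := trunc_bounds n); assert (P := trunc_pos n).
  assert (X : forall x0 p, is_RInt (fun t => re_cos x0 y t * Rpower (cos t) p)
    0 (trunc n) (cosint p (re_cos x0 y) n)).
  { intros x0 p; apply (RInt_correct (V := R_CompleteNormedModule)).
    apply ex_cosint; auto using continuous_re_cos; lra. }
  refine (is_RInt_le _ _ _ _ _ _ (Rlt_le _ _ (trunc_pos n))
    (is_RInt_minus (V := R_NormedModule) _ _ _ _ _ _ (X 0 q) (X x q))
    (is_RInt_scal (V := R_NormedModule) _ _ _ (18 * x ^ 2) _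
      (is_RInt_minus (V := R_NormedModule) _ _ _ _ _ _ (X 0 q) (X 0 (q + 2)))) _).
  intros t Ht; unfold minus, plus, opp, scal; simpl; unfold mult; simpl.
  assert (C := cos_pos_trunc n t ltac:(lra)).
  replace (q + 2) with (q + 1 + 1) by ring.
  rewrite !Rpower_succ by lra.
  assert (Hw := cosh_pos (2 * y * t)).
  rewrite re_cos_0_l; unfold re_cos.
  assert (O := one_sub_cos (2 * x * t)).
  assert (S3 := sin_ge_third t ltac:(lra)).
  assert (S2 := sin2_cos2 t); unfold Rsqr in S2.
  assert (T : t ^ 2 <= 9 * (1 - cos t * cos t)) by nra.
  assert (K : 1 - cos (2 * x * t) <= 18 * x ^ 2 * (1 - cos t * cos t)).
  { assert (x ^ 2 * t ^ 2 <= x ^ 2 * (9 * (1 - cos t * cos t)))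
      by (apply Rmult_le_compat_l; [apply pow2_ge_0|exact T]).
    nra. }
  assert (Hr : 0 < Rpower (cos t) q) by apply exp_pos.
  set (r := Rpower (cos t) q) in *; set (w := cosh (2 * y * t)) in *.
  assert (Z : (1 - cos (2 * x * t)) * (w * r) <= 18 * x ^ 2 * (1 - cos t * cos t) * (w * r)).
  { apply Rmult_le_compat_r; [apply Rmult_le_pos; lra|exact K]. }
  nra.
Qed.

(** For d = I_q(i y) and d2 = I_(q+2)(i y), the recurrence at w = (q + 2) / 2 reads (q + 2)^2 (d -
    d2) = (q + 2) d + 4 y^2 d2; with d2 <= d this makes the loss d - d2 of order d / q. *)
Lemma Icos_re_lower_rate (x y q : R) : -1 < q ->
  Icos_re 0 y q * (1 - 18 * x ^ 2 * (1 + 4 * y ^ 2) / (q + 2)) <= Icos_re x y q.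
Proof.
  intros Hq.
  assert (L := Icos_re_lower x y q Hq).
  assert (R := Icos_imag_rec y ((q + 2) / 2) ltac:(lra)).
  replace (2 * ((q + 2) / 2)) with (q + 2) in R by field.
  replace (q + 2 - 2) with q in R by ring.
  assert (D := Icos_imag_pos y q Hq).
  assert (D2 := Icos_imag_pos y (q + 2) ltac:(lra)).
  set (d := Icos_re 0 y q) in *; set (d2 := Icos_re 0 y (q + 2)) in *.
  assert (K : d - d2 <= d * ((1 + 4 * y ^ 2) / (q + 2))).
  { apply Rmult_le_reg_r with (q + 2); [lra|].
    replace (d * ((1 + 4 * y ^ 2) / (q + 2)) * (q + 2)) with (d * (1 + 4 * y ^ 2))
      by (field; lra).
    assert (Y : 0 <= y ^ 2) by apply pow2_ge_0.
    assert (d2 <= d).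
    { apply Rnot_lt_le; intros F; nra. }
    apply Rmult_le_reg_r with (q + 2); [lra|].
    assert (y ^ 2 * d2 <= y ^ 2 * (d * (q + 2)))
      by (apply Rmult_le_compat_l; [exact Y|nra]).
    nra. }
  assert (18 * x ^ 2 * (d - d2) <= 18 * x ^ 2 * (d * ((1 + 4 * y ^ 2) / (q + 2)))).
  { apply Rmult_le_compat_l; [assert (S := pow2_ge_0 x); lra|exact K]. }
  unfold Rdiv in *; lra.
Qed.

(** * Moduli of the Euler-Gauss terms and nonvanishing of Gamma *)

Lemma Cmod_rising_S_sqr (z : C) (n : nat) :
  Cmod (rising z (S n)) ^ 2 =
  Cmod (rising z n) ^ 2 * ((Re z + INR n) ^ 2 + Im z ^ 2).
Proof.
  change (rising z (S n)) with (Cmult (rising z n) (Cplus z (INR n))).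
  rewrite Cmod_mult, Rpow_mult_distr, (Cmod_sqr (Cplus z _)).
  destruct z as [a b]; simpl Re; simpl Im; rewrite Rplus_0_r; reflexivity.
Qed.

Lemma Cmod_Cexp (z : C) : Cmod (Cexp z) = exp (Re z).
Proof.
  rewrite <- (sqrt_pow2 (exp (Re z))) by (left; apply exp_pos).
  unfold Cmod, Cexp; simpl fst; simpl snd; f_equal.
  assert (S := sin2_cos2 (Im z)); unfold Rsqr in S.
  rewrite !Rpow_mult_distr.
  replace (cos (Im z) ^ 2) with (1 - sin (Im z) ^ 2) by nra; ring.
Qed.

Lemma Cmod_euler_gauss_rising (z : C) (n : nat) : ~ Gamma_pole z ->
  Cmod (euler_gauss z n) * Cmod (rising z (S n)) =
  INR (fact n) * exp (Re z * ln (INR n)).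
Proof.
  intros Hz; assert (R := rising_neq_0 z (S n) Hz).
  unfold euler_gauss; rewrite Cmod_div by exact R.
  assert (P := proj1 (Cmod_gt_0 _) R).
  rewrite Cmod_mult, Cmod_R, Cmod_Cexp, Rabs_right by (apply Rle_ge, pos_INR).
  replace (Re (Cmult z (ln (INR n)))) with (Re z * ln (INR n))
    by (destruct z as [a b]; simpl; ring).
  field; lra.
Qed.

Lemma is_lim_Cmod_euler_gauss (z : C) : ~ Gamma_pole z ->
  is_lim_seq (fun n => Cmod (euler_gauss z n)) (Cmod (Gamma z)).
Proof.
  intros Hz; destruct (Gamma_is_lim z Hz) as [A B].
  unfold Cmod.
  apply (is_lim_seq_continuous sqrt
    (fun n => fst (euler_gauss z n) ^ 2 + snd (euler_gauss z n) ^ 2)).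
  { apply continuity_pt_sqrt; simpl; nra. }
  simpl; apply is_lim_seq_plus'; repeat apply is_lim_seq_mult'; auto using is_lim_seq_const.
Qed.

(* The ratios of consecutive terms are 1 + O(1/n - 1/(n+1)), so the limit of
   their product cannot vanish. *)
Lemma Cmod_Gamma_pos (z : C) : ~ Gamma_pole z -> 0 < Cmod (Gamma z).
Proof.
  intros Hz.
  assert (M0 := Cmod_ge_0 z).
  set (K := 32 * Cmod z ^ 2 + 4 * Cmod z).
  assert (HK : 0 <= K) by (unfold K; nra).
  (* [N] is large enough both for [euler_gauss_ratio] and for K / N <= 1 / 2, which leaves at least
     half of [u N] in the limit. *)
  destruct (nfloor_ex (2 * Cmod z + 2 * K)) as [k Hk]; [lra|].
  set (N := S k).
  assert (HN : 2 * Cmod z + 2 * K <= INR N) by (unfold N; rewrite S_INR; lra).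
  assert (N1 : 1 <= INR N) by (apply (le_INR 1); unfold N; lia).
  set (u := fun n => Cmod (euler_gauss z n)).
  assert (Hstep : forall n, (N <= n)%nat ->
    u n * (1 - K * (/ INR n - / INR (S n))) <= u (S n)).
  { intros n Hn; unfold u.
    assert (Hn' := le_INR _ _ Hn).
    rewrite euler_gauss_S by (auto; unfold N in Hn; lia).
    assert (R := euler_gauss_ratio z n ltac:(unfold N in Hn; lia) ltac:(lra)).
    set (r := Cdiv _ _) in *; fold K in R.
    assert (T := Cmod_triangle r (Cminus 1 r)).
    replace (Cplus r (Cminus 1 r)) with (RtoC 1) in T by ring.
    replace (Cminus 1 r) with (Copp (Cminus r 1)) in T by ring.
    rewrite Cmod_opp, Cmod_1 in T.
    rewrite Cmod_mult; apply Rmult_le_compat_l; [apply Cmod_ge_0|lra]. }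
  assert (Hu : 0 < u N).
  { apply Cmod_gt_0; unfold euler_gauss; intros E.
    assert (C := Cmod_euler_gauss_rising z N Hz).
    unfold euler_gauss in C; rewrite E, Cmod_0, Rmult_0_l in C.
    assert (F := INR_fact_lt_0 N); assert (X := exp_pos (Re z * ln (INR N))); nra. }
  (* The losses telescope because (1 - a) (1 - b) >= 1 - (a + b) for nonnegative a and b. *)
  assert (Hlow : forall j, u N * (1 - K * (/ INR N - / INR (N + j))) <= u (N + j)%nat).
  { induction j as [|j IH].
    - rewrite Nat.add_0_r, Rminus_diag, Rmult_0_r; lra.
    - rewrite Nat.add_succ_r; set (n := (N + j)%nat) in *.
      assert (Hn : (N <= n)%nat) by (unfold n; lia).
      assert (S1 := Hstep n Hn).
      assert (Hn' := le_INR _ _ Hn).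
      assert (I1 : / INR n <= / INR N) by (apply Rinv_le_contravar; lra).
      assert (I2 : / INR (S n) <= / INR n)
        by (rewrite S_INR; apply Rinv_le_contravar; lra).
      assert (I3 : 0 < / INR (S n)) by (rewrite S_INR; apply Rinv_0_lt_compat; lra).
      assert (I4 : K * / INR n <= 1 / 2).
      { apply Rmult_le_reg_r with (INR n); [lra|].
        rewrite Rmult_assoc, Rinv_l by lra; lra. }
      set (a := K * (/ INR N - / INR n)) in *.
      set (b := K * (/ INR n - / INR (S n))) in *.
      assert (0 <= a) by (apply Rmult_le_pos; lra).
      assert (0 <= b) by (apply Rmult_le_pos; lra).
      assert (b <= 1) by (unfold b; nra).
      replace (K * (/ INR N - / INR (S n))) with (a + b) by (unfold a, b; ring).
      apply Rle_trans with (u n * (1 - b)); [|exact S1].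
      assert (0 <= u N * (a * b)) by (repeat apply Rmult_le_pos; lra).
      apply Rle_trans with (u N * (1 - a) * (1 - b)); [lra|].
      apply Rmult_le_compat_r; lra. }
  apply Rlt_le_trans with (u N * (1 / 2)); [lra|].
  refine (is_lim_seq_le_loc (fun _ => u N * (1 / 2)) u _ _ _
    (is_lim_seq_const _) (is_lim_Cmod_euler_gauss z Hz)).
  exists N; intros n Hn.
  replace n with (N + (n - N))%nat by lia.
  eapply Rle_trans; [|apply Hlow].
  apply Rmult_le_compat_l; [lra|].
  assert (0 < / INR (N + (n - N))) by (apply Rinv_0_lt_compat, lt_0_INR; unfold N; lia).
  assert (K * / INR N <= 1 / 2).
  { apply Rmult_le_reg_r with (INR N); [lra|].
    rewrite Rmult_assoc, Rinv_l by lra; lra. }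
  nra.
Qed.

(** * From the integrals to the Gamma function *)

(** The product formula for the squared quotient of the integrals, cleared of denominators and
    obtained by iterating both recurrences. *)
Lemma Icos_rising (a x y : R) (n : nat) : 1 < 2 * a ->
  Icos_sqr x y (2 * a - 2) * (Cmod (rising (a, y) n) ^ 2) ^ 2
    * Icos_re 0 y (2 * (a + INR n) - 2) ^ 2 =
  Icos_re 0 y (2 * a - 2) ^ 2
    * (Cmod (rising (a + x, y)%R n) ^ 2 * Cmod (rising (a - x, - y)%R n) ^ 2)
    * Icos_sqr x y (2 * (a + INR n) - 2).
Proof.
  intros Ha; induction n as [|n IH].
  { simpl rising; simpl INR; rewrite Cmod_1, Rplus_0_r; ring. }
  rewrite !Cmod_rising_S_sqr, S_INR; simpl Re; simpl Im.
  assert (P := pos_INR n).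
  set (w := a + INR n) in *.
  assert (Hw : 1 < 2 * w) by (unfold w; lra).
  replace (a + x + INR n) with (w + x) by (unfold w; ring).
  replace (a - x + INR n) with (w - x) by (unfold w; ring).
  replace (2 * (a + (INR n + 1)) - 2) with (2 * w) by (unfold w; ring).
  assert (E1 := Icos_sqr_rec x y w Hw).
  assert (E2 := Icos_imag_rec y w Hw).
  set (c := 2 * w * (2 * w - 1)) in *.
  (* The factor [c ^ 2] lets both recurrences act on the integrals with exponent 2 w - 2; each
     contributes 16 = 4^2, which cancels. *)
  apply (Rmult_eq_compat_l (c ^ 2)) in IH.
  apply Rmult_eq_reg_l with 16; [|lra].
  match type of IH with ?A * (?B * ?C * ?D ^ 2) = _ * (?E * ?F * ?G) =>
    replace (A * (B * C * D ^ 2)) with (B * C * (c * D) ^ 2) in IH by ring;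
    replace (A * (E * F * G)) with (E * F * (A * G)) in IH by ring
  end.
  rewrite E1, E2 in IH.
  etransitivity; [|etransitivity; [exact IH|]]; ring.
Qed.

(** The limit of [Icos_rising], using the lower bound 1 - O(1/n) for the last quotient; strictness
    is left to [Icos_sqr_lt]. *)
Lemma Gamma_Icos_le (a x y : R) : 1 < 2 * a ->
  ~ Gamma_pole (a, y) -> ~ Gamma_pole (a + x, y)%R -> ~ Gamma_pole (a - x, - y)%R ->
  Icos_re 0 y (2 * a - 2) ^ 2 * (Cmod (Gamma (a, y)) ^ 2) ^ 2 <=
  Icos_sqr x y (2 * a - 2)
    * (Cmod (Gamma (a + x, y)%R) * Cmod (Gamma (a - x, - y)%R)) ^ 2.
Proof.
  intros Ha H0 H1 H2.
  set (D0 := Icos_re 0 y (2 * a - 2)); set (N0 := Icos_sqr x y (2 * a - 2)).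
  set (K := 18 * x ^ 2 * (1 + 4 * y ^ 2)).
  (* This is [K / (q + 2)] for q = 2 (a + n + 1) - 2; the shift is there because the n-th
     Euler-Gauss term has n + 1 factors below. *)
  set (eps := fun n => K * / (2 * (a + INR (S n)))).
  assert (L0 := is_lim_Cmod_euler_gauss _ H0).
  assert (L1 := is_lim_Cmod_euler_gauss _ H1).
  assert (L2 := is_lim_Cmod_euler_gauss _ H2).
  assert (Leps : is_lim_seq eps 0).
  { replace 0 with (K * 0) by ring.
    apply is_lim_seq_mult'; [apply is_lim_seq_const|].
    apply is_lim_seq_le_le with (u := fun _ => 0) (w := fun n => / INR (S n)).
    - intros n; rewrite S_INR; assert (P := pos_INR n); split.
      + left; apply Rinv_0_lt_compat; lra.
      + apply Rinv_le_contravar; lra.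
    - apply is_lim_seq_const.
    - apply -> (is_lim_seq_incr_1 (fun n => / INR n)).
      change (Finite 0) with (Rbar_inv p_infty).
      apply is_lim_seq_inv; [apply is_lim_seq_INR|discriminate]. }
  set (g := fun n => Cmod (euler_gauss (a + x, y)%R n)
                     * Cmod (euler_gauss (a - x, - y)%R n)).
  set (h := fun n => Cmod (euler_gauss (a, y) n) ^ 2).
  assert (Key : forall n, D0 ^ 2 * h n ^ 2 * (1 - 2 * eps n) <= N0 * g n ^ 2).
  { intros n.
    assert (P := pos_INR n).
    assert (E := Icos_rising a x y (S n) Ha); fold D0 N0 in E.
    assert (E0 := Cmod_euler_gauss_rising _ n H0).
    assert (E1 := Cmod_euler_gauss_rising _ n H1).
    assert (E2 := Cmod_euler_gauss_rising _ n H2).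
    simpl Re in E0, E1, E2.
    set (q := 2 * (a + INR (S n)) - 2) in *.
    assert (Hq : -1 < q) by (unfold q; rewrite S_INR; lra).
    assert (D := Icos_imag_pos y q Hq).
    assert (A := Icos_re_lower_rate x y q Hq); fold K in A.
    replace (K / (q + 2)) with (eps n) in A
      by (unfold eps, Rdiv; do 2 f_equal; unfold q; ring).
    set (r0 := Cmod (rising (a, y) (S n))) in *.
    set (r1 := Cmod (rising (a + x, y)%R (S n))) in *.
    set (r2 := Cmod (rising (a - x, - y)%R (S n))) in *.
    set (d := Icos_re 0 y q) in *.
    (* The exponents satisfy (a + x) + (a - x) = a + a, so both pairs of Euler-Gauss terms have
       numerators of the same modulus [X]. *)
    set (X := (INR (fact n)) ^ 2 * exp (2 * a * ln (INR n))).
    assert (X0 : 0 < X).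
    { apply Rmult_lt_0_compat; [apply pow_lt, INR_fact_lt_0|apply exp_pos]. }
    assert (F0 : h n * r0 ^ 2 = X).
    { unfold h, X; rewrite <- Rpow_mult_distr, E0.
      replace (2 * a * ln (INR n)) with (a * ln (INR n) + a * ln (INR n)) by ring.
      rewrite exp_plus; ring. }
    assert (F1 : g n * (r1 * r2) = X).
    { unfold g, X.
      replace (2 * a * ln (INR n)) with ((a + x) * ln (INR n) + (a - x) * ln (INR n)) by ring.
      rewrite exp_plus; transitivity
        (Cmod (euler_gauss (a + x, y)%R n) * r1 * (Cmod (euler_gauss (a - x, - y)%R n) * r2));
        [ring|rewrite E1, E2; ring]. }
    assert (G : N0 * g n ^ 2 * d ^ 2 = D0 ^ 2 * h n ^ 2 * Icos_sqr x y q).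
    (* [X] is read as [h n * r0 ^ 2] on the left and as [g n * (r1 * r2)] on the right. *)
    { apply Rmult_eq_reg_l with (X ^ 2); [|nra].
      transitivity (h n ^ 2 * g n ^ 2 * (N0 * (r0 ^ 2) ^ 2 * d ^ 2));
        [rewrite <- F0 | rewrite E; rewrite <- F1]; ring. }
    (* Uses R^2 >= 2 d R - d^2 for R = [Icos_re x y q], which is valid even when 1 - eps is
       negative. *)
    assert (B : d ^ 2 * (1 - 2 * eps n) <= Icos_sqr x y q).
    { unfold Icos_sqr; assert (S1 := pow2_ge_0 (Icos_im x y q)).
      assert (S2 := pow2_ge_0 (Icos_re x y q - d)).
      nra. }
    apply Rmult_le_reg_r with (d ^ 2); [nra|].
    rewrite G; replace (D0 ^ 2 * h n ^ 2 * (1 - 2 * eps n) * d ^ 2)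
      with (D0 ^ 2 * h n ^ 2 * (d ^ 2 * (1 - 2 * eps n))) by ring.
    apply Rmult_le_compat_l; [|exact B].
    apply Rmult_le_pos; apply pow2_ge_0. }
  replace (D0 ^ 2 * (Cmod (Gamma (a, y)) ^ 2) ^ 2)
    with (D0 ^ 2 * (Cmod (Gamma (a, y)) ^ 2) ^ 2 * (1 - 2 * 0)) by ring.
  assert (Sq : forall v l, is_lim_seq v (Finite l) ->
    is_lim_seq (fun n => v n ^ 2) (Finite (l ^ 2))).
  { intros v l Hv; simpl; repeat apply is_lim_seq_mult'; auto using is_lim_seq_const. }
  match goal with |- ?A <= ?B => change (Rbar_le A B) end.
  refine (is_lim_seq_le _ _ _ _ Key _ _).
  - apply is_lim_seq_mult'.
    + apply is_lim_seq_mult'; [apply is_lim_seq_const|]; apply Sq, Sq, L0.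
    + apply is_lim_seq_minus'; [apply is_lim_seq_const|].
      apply is_lim_seq_mult'; [apply is_lim_seq_const|exact Leps].
  - apply is_lim_seq_mult'; [apply is_lim_seq_const|].
    apply Sq, is_lim_seq_mult'; assumption.
Qed.

Lemma not_Gamma_pole_Re_pos (z : C) : 0 < Re z -> ~ Gamma_pole z.
Proof.
  intros H [n E]; rewrite E in H; simpl in H; assert (P := pos_INR n); lra.
Qed.

Theorem lemma5p3 (alpha x y : R) (Halpha : 1 < alpha) (Hx : 0 < x)
  (Hfin : ~ Gamma_pole (RtoC (alpha / 2) - RtoC x - Ci * RtoC y)%C) :
  Cmod (Gamma (RtoC (alpha / 2) + RtoC x + Ci * RtoC y)
        * Gamma (RtoC (alpha / 2) - RtoC x - Ci * RtoC y))%C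
  > (Cmod (Gamma (RtoC (alpha / 2) + Ci * RtoC y)%C)) ^ 2.
Proof.
  set (a := alpha / 2) in *.
  assert (Ha : 1 < 2 * a) by (unfold a; lra).
  replace (RtoC a + RtoC x + Ci * RtoC y)%C with ((a + x, y)%R : C)
    by (apply injective_projections; simpl; ring).
  replace (RtoC a + Ci * RtoC y)%C with ((a, y) : C)
    by (apply injective_projections; simpl; ring).
  replace (RtoC a - RtoC x - Ci * RtoC y)%C with ((a - x, - y)%R : C) in *
    by (apply injective_projections; simpl; ring).
  assert (H0 : ~ Gamma_pole (a, y)) by (apply not_Gamma_pole_Re_pos; simpl; lra).
  assert (H1 : ~ Gamma_pole (a + x, y)%R) by (apply not_Gamma_pole_Re_pos; simpl; lra).
  assert (L := Gamma_Icos_le a x y Ha H0 H1 Hfin).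
  assert (S := Icos_sqr_lt x y (2 * a - 2) Hx ltac:(lra)).
  rewrite Cmod_mult.
  assert (P := Rmult_lt_0_compat _ _ (Cmod_Gamma_pos _ H1) (Cmod_Gamma_pos _ Hfin)).
  set (p := Cmod (Gamma (a + x, y)%R) * Cmod (Gamma (a - x, - y)%R)) in *.
  set (g := Cmod (Gamma (a, y)) ^ 2) in *.
  set (D := Icos_re 0 y (2 * a - 2) ^ 2) in *.
  (* If p <= g, then D g^2 <= N p^2 < D p^2 <= D g^2 with N = [Icos_sqr x y (2 * a - 2)]; the strict
     step uses p > 0. *)
  apply Rnot_le_gt; intros F.
  assert (p ^ 2 <= g ^ 2) by (apply pow_incr; lra).
  assert (0 < p ^ 2) by nra.
  assert (0 <= D) by apply pow2_ge_0.
  nra.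
Qed.
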